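(* Let $P$ denote the Petersen graph. Then $F_d(P)=5=Z(P)$.
   Context: Zero forcing: given a set $B\subseteq V(G)$ of initially black vertices (all others white) of a finite simple graph $G$, at each step a black vertex having exactly one white neighbor forces that neighbor to become black; $B$ is a zero forcing set of $G$ if repeated application of this rule turns all vertices black. $Z(G)$ is the minimum cardinality of a zero forcing set. A set $D\subseteq V(G)$ is dominating if every vertex of $G$ is in $D$ or adjacent to a vertex of $D$. A dom-forcing set of $G$ is a set $D_f\subseteq V(G)$ that is both a dominating set of $G$ and a zero forcing set of $G$; the dom-forcing number $F_d(G)$ is the minimum cardinality of a dom-forcing set. *)

(* Defs.v *)
From mathcomp Require Import all_boot.

Set Implicit Arguments.
Unset Strict Implicit.
Unset Printing Implicit Defensive.

Record sgraph := SGraph {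
  vertex :> finType;
  adj : rel vertex;
  adj_sym : symmetric adj;
  adj_irr : irreflexive adj }.

Section ZeroForcing.
Variable G : sgraph.
Implicit Types (B C D : {set G}) (u v : G).

Definition white_neighbors B u : {set G} := [set w | adj u w & w \notin B].

Definition forces B u v : bool :=
  (u \in B) && (white_neighbors B u == [set v]).

(* Forces are performed one at a time. *)
Definition force_step : rel {set G} :=
  [rel B C | [exists u, exists v, forces B u v && (C == v |: B)]].

Definition zero_forcing B : bool := connect force_step B [set: G].

Definition dominating D : bool :=
  [forall v, (v \in D) || [exists u in D, adj v u]].

Definition dom_forcing D : bool := dominating D && zero_forcing D.

Lemma zero_forcing_setT : zero_forcing [set: G].
Proof. exact: connect0. Qed.

Lemma dom_forcing_setT : dom_forcing [set: G].
Proof.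
by rewrite /dom_forcing zero_forcing_setT andbT; apply/forallP=> v; rewrite inE.
Qed.

(* [set: G] is an admissible starting point for both minimizations, by the
   two lemmas above, so each [arg min] is a true minimizer. *)
Definition zero_forcing_number : nat :=
  #|[arg min_(B < [set: G] | zero_forcing B) #|B| ]|.

Definition dom_forcing_number : nat :=
  #|[arg min_(D < [set: G] | dom_forcing D) #|D| ]|.

End ZeroForcing.

(* The Petersen graph as the Kneser graph K(5, 2): the vertices are the
   2-element subsets of a 5-element set, adjacent when disjoint. *)
Definition pair5 : finType := {A : {set 'I_5} | #|A| == 2}.

Definition petersen_adj (A B : pair5) : bool := [disjoint val A & val B].

Lemma petersen_adj_sym : symmetric petersen_adj.
Proof. by move=> A B; rewrite /petersen_adj /= disjoint_sym. Qed.

Lemma petersen_adj_irr : irreflexive petersen_adj.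
Proof.
move=> A; rewrite /petersen_adj /= -setI_eq0 setIid -cards_eq0.
by rewrite (eqP (valP A)).
Qed.

Definition petersen : sgraph := SGraph petersen_adj_sym petersen_adj_irr.

(* Main.v *)
Require Import Defs.
From mathcomp Require Import all_boot.
From mathcomp Require Import ssralg zmodp.

(** Lower bound: if a function on the vertices with values in ['F_3] has, at
    every vertex, the sum of its values over the neighbours equal to its value
    there, and it vanishes on a zero forcing set, then it vanishes everywhere,
    since each force propagates the zeros.  Viewing the vertices of the Petersen
    graph as the edges of [K_5], such eigenfunctions include the edge weightings
    whose sum at each of the five points is zero (the total weight is then zero
    because 2 is invertible).  By pigeonhole, as [3 ^ 6 > 3 ^ 5], a nonzero one
    vanishes on any prescribed four vertices.
    Upper bound: the 5-cycle formed by the pairs [{i, i + 1}] dominates, and each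
    of its vertices forces its only neighbour off the cycle. *)

Set Implicit Arguments.
Unset Strict Implicit.
Unset Printing Implicit Defensive.

Import GRing.Theory.

Section ZeroForcingFacts.
Local Open Scope ring_scope.
Variable G : sgraph.
Implicit Types (B C : {set G}) (u v : G).

Lemma forcesP B u v :
  reflect (u \in B /\ forall w, (adj u w && (w \notin B)) = (w == v))
          (forces B u v).
Proof.
apply: (iffP andP) => -[uB].
  by move=> /eqP/setP h; split=> // w; have := h w; rewrite !inE.
by move=> h; split=> //; apply/eqP/setP => w; rewrite !inE h.
Qed.

(** Enlarging the black set only shrinks the white neighbourhood of [u], and [v] stays in it as long
    as [v] is white. *)
Lemma forcesS B C u v :
  B \subset C -> v \notin C -> forces B u v -> forces C u v.
Proof.
move=> sBC vC /forcesP[uB h]; apply/forcesP; split; first exact: (subsetP sBC).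
move=> w; apply/idP/eqP => [/andP[uw wC]|->].
  by apply/eqP; rewrite -h uw /=; apply: contraNN wC => /(subsetP sBC).
by have := h v; rewrite eqxx vC => /andP[->].
Qed.

(** By [forcesS], forces available at the start stay available until their targets turn black, so
    they can be performed one at a time in any order. *)
Lemma zero_forcing_one_round B :
  (forall v, v \notin B -> exists u, forces B u v) -> zero_forcing B.
Proof.
move=> hB; suff H n C : B \subset C -> (#|~: C| <= n)%N -> zero_forcing C.
  exact: (H #|~: B|).
elim: n C => [|n IHn] C sBC.
  rewrite leqn0 cards_eq0 => /eqP C0.
  by rewrite -(setCK C) C0 setC0 zero_forcing_setT.
case: (eqVneq C setT) => [->|]; first by rewrite zero_forcing_setT.
rewrite -subTset => /subsetPn[v _ vC] leCn.
have [u Bu] : exists u, forces B u v.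
  by apply: hB; apply: contraNN vC => /(subsetP sBC).
apply: (@connect_trans _ _ (v |: C)).
  apply: connect1; apply/existsP; exists u; apply/existsP; exists v.
  by rewrite (forcesS sBC vC Bu) eqxx.
apply: IHn; first by rewrite subsetU // sBC orbT.
by move: leCn; rewrite (cardsD1 v (~: C)) inE vC setCU setIC -setDE.
Qed.

(** Domination comes for free: the vertex forcing [v] is a black neighbour of [v]. *)
Lemma dom_forcing_one_round B :
  (forall v, v \notin B -> exists u, forces B u v) -> dom_forcing B.
Proof.
move=> hB; rewrite /dom_forcing (zero_forcing_one_round hB) andbT.
apply/forallP => v; apply/orP; case: (boolP (v \in B)) => [|vB]; [by left|right].
have [u /forcesP[uB /(_ v)]] := hB v vB; rewrite eqxx vB andbT => uv.
by apply/existsP; exists u; rewrite uB adj_sym.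
Qed.

Lemma zero_forcing_eigenfunction_eq0 (R : nmodType) (h : G -> R) B :
  (forall u, \sum_(w | adj u w) h w = h u) ->
  zero_forcing B -> (forall u, u \in B -> h u = 0) -> forall u, h u = 0.
Proof.
move=> hE /connectP[p pB Bp] hB u.
have: u \in [set: G] by [].
rewrite {}Bp; elim: p B pB hB => [|C p IHp] B /=; first by move=> _; apply.
case/andP=> /existsP[x /existsP[v /andP[/forcesP[xB xv] /eqP->]]] pC hB.
apply: IHp => // w /setU1P[->|/hB//].
have /andP[adjxv vB] : adj x v && (v \notin B) by rewrite xv.
(* All neighbours of [x] except [v] are black, so the equation at [x] reduces to [h v = h x = 0]. *)
rewrite -(hB x xB) -(hE x) (bigD1 v) //= big1 ?addr0 // => y /andP[xy yv].
by apply: hB; apply: contraNT yv => yB; rewrite -xv xy.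
Qed.

End ZeroForcingFacts.

Section PointSums.
Local Open Scope ring_scope.
Variables (R : nmodType) (f : pair5 -> R).

Definition point_sum i : R := \sum_(A : pair5 | i \in val A) f A.

(** Double counting: [A] contributes once for each of its points in [S]. *)
Lemma sum_point_sum (S : {set 'I_5}) :
  \sum_(i in S) point_sum i = \sum_(A : pair5) f A *+ #|S :&: val A|.
Proof.
rewrite /point_sum (exchange_big_dep predT) //=; apply: eq_bigr => A _.
by rewrite sumr_const; congr (_ *+ _); apply: eq_card => i; rewrite !inE.
Qed.

(* For two pairs, [|A :&: B| + [A disjoint from B] = 1 + [A = B]]. *)
Lemma petersen_sum_neighbors (A : pair5) :
  \sum_(B | petersen_adj A B) f B + \sum_(i in val A) point_sum i
  = \sum_B f B + f A.
Proof.
rewrite sum_point_sum big_mkcond -big_split /=.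
have -> : f A = \sum_B (if B == A then f B else 0).
  by rewrite -big_mkcond big_pred1_eq.
rewrite -big_split /=.
apply: eq_bigr => B _; rewrite /petersen_adj -setI_eq0 -cards_eq0.
have := subset_leq_card (subsetIl (val A) (val B)); rewrite (eqP (valP A)).
have -> : (B == A) = (#|val A :&: val B| == 2).
  apply/eqP/eqP => [->|h]; first by rewrite setIid (eqP (valP A)).
  apply: val_inj; have /eqP : val A :&: val B == val A.
    by rewrite eqEcard subsetIl h (eqP (valP A)).
  move/setIidPl => sAB; apply/esym/eqP.
  by rewrite eqEcard sAB (eqP (valP A)) (eqP (valP B)).
by case: #|_| => [|[|[|]]] //= _; rewrite ?mulr0n ?mulr1n ?mulr2n ?addr0 ?add0r.
Qed.

Lemma double_sum_petersen : (\sum_A f A) *+ 2 = \sum_i point_sum i.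
Proof.
transitivity (\sum_(i in [set: 'I_5]) point_sum i); last first.
  by apply: eq_bigl => i; rewrite inE.
rewrite sum_point_sum -sumrMnl.
by apply: eq_bigr => A _; rewrite setTI (eqP (valP A)).
Qed.

End PointSums.

Lemma card_pair5 : #|pair5| = 10.
Proof.
rewrite card_sig -(cardsE [pred A : {set 'I_5} | #|A| == 2]).
by rewrite card_draws card_ord.
Qed.

Section LowerBound.
Local Open Scope ring_scope.

Lemma exists_petersen_eigenfunction (B : {set pair5}) : (#|B| <= 4)%N ->
  exists h : pair5 -> 'F_3,
    [/\ exists A, h A != 0, forall A, A \in B -> h A = 0
      & forall A, \sum_(C | petersen_adj A C) h C = h A].
Proof.
move=> leB4.
pose D : pred {ffun pair5 -> 'F_3} := pffun_on (0 : 'F_3) (~: B) predT.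
pose s (f : {ffun pair5 -> 'F_3}) := [ffun i => point_sum f i].
(* Two distinct functions vanishing on [B] share all point sums; their difference will be [h]. *)
have /dinjectivePn[f fD [g /andP[gf gD] sfg]] : ~~ dinjectiveb s D.
  apply/negP => /dinjectiveP/card_in_image cD.
  have := max_card [pred y | y \in image s D]; rewrite cD leqNgt => /negP[].
  rewrite card_ffun card_pffun_on card_Fp // card_ord.
  (* Comparing exponents leaves [5 < #|~: B|]: at most four of the ten pairs lie in [B]. *)
  rewrite ltn_exp2l // -(ltn_add2l #|B|) cardsC card_pair5.
  by rewrite -addnS (leq_add2r 6 _ 4).
pose h A := f A - g A.
have off A (k : {ffun pair5 -> 'F_3}) : k \in D -> A \in B -> k A = 0.
  move/(@pffun_onP _ _ 0 (~: B) predT k) => [/subsetP sk _] AB.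
  by apply/eqP; apply: contraTT AB => kA; have := sk A; rewrite !inE => ->.
have hs i : point_sum h i = 0.
  rewrite /point_sum sumrB; apply/eqP; rewrite subr_eq0; apply/eqP.
  by move/ffunP/(_ i): sfg; rewrite !ffunE.
have h0 : \sum_A h A = 0.
  have /eqP : (\sum_A h A) *+ 2 = 0 by rewrite double_sum_petersen big1.
  (* The test [2 == 0] computes to [false] in ['F_3]. *)
  by rewrite -mulr_natr mulf_eq0 orbF => /eqP.
exists h; split=> [|A AB|A].
- apply/existsP; apply: contraNT gf; rewrite negb_exists => /forallP fg.
  apply/eqP/ffunP => A; have := fg A; rewrite negbK subr_eq0.
  by move/eqP.
- by rewrite /h !off ?subrr.
- rewrite -[RHS](_ : \sum_C h C + h A = _); last by rewrite h0 add0r.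
  by rewrite -petersen_sum_neighbors [X in _ + X]big1 ?addr0.
Qed.

Lemma petersen_zero_forcing_card (B : {set petersen}) :
  zero_forcing B -> (5 <= #|B|)%N.
Proof.
move=> zB; rewrite leqNgt ltnS; apply/negP => leB4.
have [h [[A /eqP hA] hB hE]] := exists_petersen_eigenfunction leB4.
exact: hA (@zero_forcing_eigenfunction_eq0 petersen _ h B hE zB hB A).
Qed.

End LowerBound.

Section UpperBound.

Lemma eq_set2 (T : finType) (a b c d : T) :
  ([set a; b] == [set c; d])
  = [|| (a == c) && (b == d) | (a == d) && (b == c)].
Proof.
apply/eqP/orP => [/setP e|[]/andP[/eqP-> /eqP->] //]; last exact: setUC.
have := e a; have := e b; have := e c; have := e d.
rewrite !inE !eqxx !orbT /= (eq_sym c a) (eq_sym d a) (eq_sym c b) (eq_sym d b).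
by case: (a == c); case: (a == d); case: (b == c); case: (b == d); auto.
Qed.

Lemma card_edge (i : 'I_5) : #|[set i; ordS i]| == 2.
Proof. by rewrite cards2; case: i => [[|[|[|[|[|?]]]]] ?]. Qed.

Definition edge (i : 'I_5) : petersen := exist _ [set i; ordS i] (card_edge i).

Definition cycle5 : {set petersen} := [set edge i | i : 'I_5].

Lemma card_cycle5 : #|cycle5| = 5.
Proof.
rewrite card_imset ?card_ord // => i j /(congr1 val)/eqP /=.
rewrite eq_set2 -!val_eqE => h; apply/val_inj/eqP; move: h.
by case: i j => [[|[|[|[|[|?]]]]] ?] // [[|[|[|[|[|?]]]]] ?].
Qed.

Lemma mem_cycle5 (v : petersen) a b : val v = [set a; b] ->
  (v \in cycle5) = (b == ordS a) || (a == ordS b).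
Proof.
move=> vE; apply/imsetP/orP => [[i _ vi]|[]/eqP e].
- move: vE; rewrite vi => /eqP; rewrite /= eq_set2.
  by case/orP=> /andP[/eqP<- /eqP<-]; auto.
- by exists a => //; apply: val_inj; rewrite vE e.
- by exists b => //; apply: val_inj; rewrite vE e setUC.
Qed.

(* [edge (a + 3)] is the pair [{a + 3, a + 4}], whose neighbours are the pairs
   inside [{a, a + 1, a + 2}]. *)
Lemma edge_forces (v : petersen) a : val v = [set a; ordS (ordS a)] ->
  forces cycle5 (edge (iter 3 (@ordS _) a)) v.
Proof.
move=> vE; apply/forcesP; split=> [|w]; first exact: imset_f.
have /cards2P[c [d [cd wE]]] := valP w.
rewrite (mem_cycle5 wE) -(val_eqE w v) [adj _ _]/(petersen_adj _ _) /petersen_adj.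
rewrite vE wE eq_set2 disjoints_subset /= subUset !sub1set !inE -!val_eqE.
(* Only a statement about residues modulo 5 remains, checked for all values of [a], [c] and [d]. *)
move: cd; rewrite -val_eqE; clear; case: a c d => [[|[|[|[|[|?]]]]] ?] //.
all: by case=> [[|[|[|[|[|?]]]]] ?] // [[|[|[|[|[|?]]]]] ?].
Qed.

Lemma dom_forcing_cycle5 : dom_forcing cycle5.
Proof.
apply: dom_forcing_one_round => v.
have /cards2P[a [b [ab vE]]] := valP v; rewrite (mem_cycle5 vE) => h.
(* Distinct residues modulo 5 that are not consecutive differ by 2, in one order or the other. *)
have /orP[/eqP e|/eqP e] : (b == ordS (ordS a)) || (a == ordS (ordS b)).
- move: ab h; rewrite -!val_eqE; clear.
  by case: a b => [[|[|[|[|[|?]]]]] ?] // [[|[|[|[|[|?]]]]] ?].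
- by exists (edge (iter 3 (@ordS _) a)); apply: edge_forces; rewrite vE e.
- by exists (edge (iter 3 (@ordS _) b)); apply: edge_forces; rewrite vE e setUC.
Qed.

End UpperBound.

Theorem theorem3p16 :
  dom_forcing_number petersen = 5 /\ zero_forcing_number petersen = 5.
Proof.
have /andP[_ zc] := dom_forcing_cycle5; split.
- rewrite /dom_forcing_number.
  case: arg_minnP => [|D /andP[_ zD] /(_ _ dom_forcing_cycle5)].
    exact: dom_forcing_setT.
  rewrite card_cycle5 => leD5; apply/eqP; rewrite eqn_leq leD5 /=.
  exact: petersen_zero_forcing_card.
- rewrite /zero_forcing_number.
  case: arg_minnP => [|B zB /(_ _ zc)]; first exact: zero_forcing_setT.
  rewrite card_cycle5 => leB5; apply/eqP; rewrite eqn_leq leB5 /=.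
  exact: petersen_zero_forcing_card.
Qed.
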